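(* Work in intensional Martin-Löf type theory with propositional truncation satisfying the judgmental computation rule $\mathrm{rec}(P,h,f,|x|)\equiv f(x)$. Let $X,Y:\mathcal U$, $f:X\to Y$, $\bar f:\lVert X\rVert\to Y$ and $h:\prod_{x:X}f(x)=\bar f(|x|)$. Then one can construct $f':\lVert X\rVert\to Y$ such that for a variable $x:X$ one has the judgmental equality $f(x)\equiv f'(|x|)$; in particular $\lambda x.\,\mathsf{refl}_{f(x)}$ is a term of type $\prod_{x:X}f(x)=f'(|x|)$.
   Context: Intensional Martin-Löf type theory with a universe $\mathcal U$, $\Sigma$, $\Pi$, $+$, identity types (J only; no UIP/K) and judgmental $\eta$ for functions. $\mathrm{isProp}(A):\equiv\prod_{a,b:A}a=b$. Propositional truncation: for every $A:\mathcal U$ a type $\lVert A\rVert:\mathcal U$ with $|{-}|:A\to\lVert A\rVert$, a proof of $\mathrm{isProp}(\lVert A\rVert)$, and $\mathrm{rec}:\prod_{P:\mathcal U}\mathrm{isProp}(P)\to(A\to P)\to\lVert A\rVert\to P$, with $\mathrm{rec}(P,h,f,|x|)\equiv f(x)$ judgmentally. *)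

(* Defs.v *)
(* Judgmental equality cannot be expressed by a proposition inside Rocq, so the
   type theory is formalized as an object language: raw terms and the
   inductively defined derivable judgments. *)
From Stdlib Require Import List.
Import ListNotations.

(* Raw terms with de Bruijn indices; [tVar 0] is the innermost variable.
   Bound variables:
     tPi A B, tSig A B, tLam A t       one in [B], resp. [t];
     tSplit C d p                      one in [C]; two in [d] (the first
                                       component is 1, the second is 0);
     tCase C d e s                     one in each of [C], [d], [e];
     tJ C d a b p                      three in [C] (left endpoint 2, right
                                       endpoint 1, path 0); one in [d].
   The universe is a la Russell: codes and types share one syntax. *)
Inductive tm : Type :=
| tVar (n : nat)
| tU
| tPi (A B : tm)
| tLam (A t : tm)
| tApp (f a : tm)
| tSig (A B : tm)
| tPair (a b : tm)
| tSplit (C d p : tm)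
| tSum (A B : tm)
| tInl (a : tm)
| tInr (b : tm)
| tCase (C d e s : tm)
| tId (A a b : tm)
| tRefl (a : tm)
| tJ (C d a b p : tm)
| tTrunc (A : tm)
| tTr (a : tm)
| tTrProp (A : tm)
| tTrRec (P h f t : tm).

Definition up_ren (r : nat -> nat) (n : nat) : nat :=
  match n with 0 => 0 | S m => S (r m) end.

Fixpoint ren (r : nat -> nat) (t : tm) : tm :=
  let r1 := up_ren r in
  let r2 := up_ren r1 in
  let r3 := up_ren r2 in
  match t with
  | tVar n => tVar (r n)
  | tU => tU
  | tPi A B => tPi (ren r A) (ren r1 B)
  | tLam A t => tLam (ren r A) (ren r1 t)
  | tApp f a => tApp (ren r f) (ren r a)
  | tSig A B => tSig (ren r A) (ren r1 B)
  | tPair a b => tPair (ren r a) (ren r b)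
  | tSplit C d p => tSplit (ren r1 C) (ren r2 d) (ren r p)
  | tSum A B => tSum (ren r A) (ren r B)
  | tInl a => tInl (ren r a)
  | tInr b => tInr (ren r b)
  | tCase C d e s => tCase (ren r1 C) (ren r1 d) (ren r1 e) (ren r s)
  | tId A a b => tId (ren r A) (ren r a) (ren r b)
  | tRefl a => tRefl (ren r a)
  | tJ C d a b p => tJ (ren r3 C) (ren r1 d) (ren r a) (ren r b) (ren r p)
  | tTrunc A => tTrunc (ren r A)
  | tTr a => tTr (ren r a)
  | tTrProp A => tTrProp (ren r A)
  | tTrRec P h f t => tTrRec (ren r P) (ren r h) (ren r f) (ren r t)
  end.

Definition wk (t : tm) : tm := ren S t.

Definition scons (t : tm) (s : nat -> tm) (n : nat) : tm :=
  match n with 0 => t | S m => s m end.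

Definition up (s : nat -> tm) : nat -> tm :=
  scons (tVar 0) (fun n => wk (s n)).

Fixpoint subst (s : nat -> tm) (t : tm) : tm :=
  let s1 := up s in
  let s2 := up s1 in
  let s3 := up s2 in
  match t with
  | tVar n => s n
  | tU => tU
  | tPi A B => tPi (subst s A) (subst s1 B)
  | tLam A t => tLam (subst s A) (subst s1 t)
  | tApp f a => tApp (subst s f) (subst s a)
  | tSig A B => tSig (subst s A) (subst s1 B)
  | tPair a b => tPair (subst s a) (subst s b)
  | tSplit C d p => tSplit (subst s1 C) (subst s2 d) (subst s p)
  | tSum A B => tSum (subst s A) (subst s B)
  | tInl a => tInl (subst s a)
  | tInr b => tInr (subst s b)
  | tCase C d e u => tCase (subst s1 C) (subst s1 d) (subst s1 e) (subst s u)
  | tId A a b => tId (subst s A) (subst s a) (subst s b)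
  | tRefl a => tRefl (subst s a)
  | tJ C d a b p => tJ (subst s3 C) (subst s1 d) (subst s a) (subst s b) (subst s p)
  | tTrunc A => tTrunc (subst s A)
  | tTr a => tTr (subst s a)
  | tTrProp A => tTrProp (subst s A)
  | tTrRec P h f t => tTrRec (subst s P) (subst s h) (subst s f) (subst s t)
  end.

Definition inst1 (t a : tm) : tm := subst (scons a tVar) t.
Definition inst2 (t a b : tm) : tm := subst (scons b (scons a tVar)) t.
Definition inst3 (t a b c : tm) : tm :=
  subst (scons c (scons b (scons a tVar))) t.

Definition tArr (A B : tm) : tm := tPi A (wk B).

Definition tIsProp (A : tm) : tm :=
  tPi A (tPi (wk A) (tId (wk (wk A)) (tVar 1) (tVar 0))).

(* The motives of the eliminators, moved to the contexts of their branches: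
   C(pair x y) for x : A, y : B(x);  C(inl x) for x : A;  C(inr y) for y : B;
   C(x, x, refl x) for x : A. *)
Definition motive_pair (C : tm) : tm :=
  subst (scons (tPair (tVar 1) (tVar 0)) (fun n => tVar (S (S n)))) C.
Definition motive_inl (C : tm) : tm :=
  subst (scons (tInl (tVar 0)) (fun n => tVar (S n))) C.
Definition motive_inr (C : tm) : tm :=
  subst (scons (tInr (tVar 0)) (fun n => tVar (S n))) C.
Definition motive_refl (C : tm) : tm :=
  subst (scons (tRefl (tVar 0)) (scons (tVar 0) (scons (tVar 0)
    (fun n => tVar (S n))))) C.

(* Contexts list the most recent variable first. *)
Definition ctx : Type := list tm.

(* x : A, y : A, p : x = y *)
Definition ctx_J (G : ctx) (A : tm) : ctx :=
  tId (wk (wk A)) (tVar 1) (tVar 0) :: wk A :: A :: G.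

(* wf G          G is a context
   isty G A      G |- A type
   eqty G A B    G |- A == B type   (judgmental)
   hastm G t A   G |- t : A
   eqtm G t u A  G |- t == u : A    (judgmental) *)
Inductive wf : ctx -> Prop :=
| wf_nil : wf []
| wf_cons G A : wf G -> isty G A -> wf (A :: G)

with isty : ctx -> tm -> Prop :=
| isty_U G : wf G -> isty G tU
| isty_El G A : hastm G A tU -> isty G A
| isty_Pi G A B : isty G A -> isty (A :: G) B -> isty G (tPi A B)
| isty_Sig G A B : isty G A -> isty (A :: G) B -> isty G (tSig A B)
| isty_Sum G A B : isty G A -> isty G B -> isty G (tSum A B)
| isty_Id G A a b :
    isty G A -> hastm G a A -> hastm G b A -> isty G (tId A a b)

with eqty : ctx -> tm -> tm -> Prop :=
| eqty_refl G A : isty G A -> eqty G A A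
| eqty_sym G A B : eqty G A B -> eqty G B A
| eqty_trans G A B C : eqty G A B -> eqty G B C -> eqty G A C
| eqty_El G A B : eqtm G A B tU -> eqty G A B
| eqty_Pi G A A' B B' :
    isty G A -> eqty G A A' -> eqty (A :: G) B B' ->
    eqty G (tPi A B) (tPi A' B')
| eqty_Sig G A A' B B' :
    isty G A -> eqty G A A' -> eqty (A :: G) B B' ->
    eqty G (tSig A B) (tSig A' B')
| eqty_Sum G A A' B B' :
    eqty G A A' -> eqty G B B' -> eqty G (tSum A B) (tSum A' B')
| eqty_Id G A A' a a' b b' :
    eqty G A A' -> eqtm G a a' A -> eqtm G b b' A ->
    eqty G (tId A a b) (tId A' a' b')

with hastm : ctx -> tm -> tm -> Prop :=
| hastm_var G n A :
    wf G -> nth_error G n = Some A ->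
    hastm G (tVar n) (ren (fun k => S n + k) A)
| hastm_conv G t A B : hastm G t A -> eqty G A B -> hastm G t B
(* closure of the universe *)
| hastm_Pi G A B :
    hastm G A tU -> hastm (A :: G) B tU -> hastm G (tPi A B) tU
| hastm_Sig G A B :
    hastm G A tU -> hastm (A :: G) B tU -> hastm G (tSig A B) tU
| hastm_Sum G A B :
    hastm G A tU -> hastm G B tU -> hastm G (tSum A B) tU
| hastm_Id G A a b :
    hastm G A tU -> hastm G a A -> hastm G b A -> hastm G (tId A a b) tU
| hastm_Trunc G A : hastm G A tU -> hastm G (tTrunc A) tU
(* dependent functions *)
| hastm_lam G A B t :
    isty G A -> hastm (A :: G) t B -> hastm G (tLam A t) (tPi A B)
| hastm_app G A B f a :
    hastm G f (tPi A B) -> hastm G a A -> hastm G (tApp f a) (inst1 B a)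
(* dependent pairs *)
| hastm_pair G A B a b :
    isty G A -> isty (A :: G) B -> hastm G a A -> hastm G b (inst1 B a) ->
    hastm G (tPair a b) (tSig A B)
| hastm_split G A B C d p :
    isty G A -> isty (A :: G) B -> isty (tSig A B :: G) C ->
    hastm (B :: A :: G) d (motive_pair C) -> hastm G p (tSig A B) ->
    hastm G (tSplit C d p) (inst1 C p)
(* coproducts *)
| hastm_inl G A B a :
    isty G B -> hastm G a A -> hastm G (tInl a) (tSum A B)
| hastm_inr G A B b :
    isty G A -> hastm G b B -> hastm G (tInr b) (tSum A B)
| hastm_case G A B C d e s :
    isty G A -> isty G B -> isty (tSum A B :: G) C ->
    hastm (A :: G) d (motive_inl C) -> hastm (B :: G) e (motive_inr C) ->
    hastm G s (tSum A B) ->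
    hastm G (tCase C d e s) (inst1 C s)
(* identity types *)
| hastm_refl G A a : hastm G a A -> hastm G (tRefl a) (tId A a a)
| hastm_J G A C d a b p :
    isty G A -> isty (ctx_J G A) C -> hastm (A :: G) d (motive_refl C) ->
    hastm G a A -> hastm G b A -> hastm G p (tId A a b) ->
    hastm G (tJ C d a b p) (inst3 C a b p)
(* propositional truncation *)
| hastm_tr G A a :
    hastm G A tU -> hastm G a A -> hastm G (tTr a) (tTrunc A)
| hastm_trProp G A :
    hastm G A tU -> hastm G (tTrProp A) (tIsProp (tTrunc A))
| hastm_trRec G A P h f t :
    hastm G A tU -> hastm G P tU -> hastm G h (tIsProp P) ->
    hastm G f (tArr A P) -> hastm G t (tTrunc A) ->
    hastm G (tTrRec P h f t) P

with eqtm : ctx -> tm -> tm -> tm -> Prop :=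
| eqtm_refl G t A : hastm G t A -> eqtm G t t A
| eqtm_sym G t u A : eqtm G t u A -> eqtm G u t A
| eqtm_trans G t u v A : eqtm G t u A -> eqtm G u v A -> eqtm G t v A
| eqtm_conv G t u A B : eqtm G t u A -> eqty G A B -> eqtm G t u B
(* computation rules, and eta for functions *)
| eqtm_beta G A B t a :
    isty G A -> hastm (A :: G) t B -> hastm G a A ->
    eqtm G (tApp (tLam A t) a) (inst1 t a) (inst1 B a)
| eqtm_eta G A B f :
    hastm G f (tPi A B) ->
    eqtm G f (tLam A (tApp (wk f) (tVar 0))) (tPi A B)
| eqtm_split_pair G A B C d a b :
    isty G A -> isty (A :: G) B -> isty (tSig A B :: G) C ->
    hastm (B :: A :: G) d (motive_pair C) ->
    hastm G a A -> hastm G b (inst1 B a) ->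
    eqtm G (tSplit C d (tPair a b)) (inst2 d a b) (inst1 C (tPair a b))
| eqtm_case_inl G A B C d e a :
    isty G A -> isty G B -> isty (tSum A B :: G) C ->
    hastm (A :: G) d (motive_inl C) -> hastm (B :: G) e (motive_inr C) ->
    hastm G a A ->
    eqtm G (tCase C d e (tInl a)) (inst1 d a) (inst1 C (tInl a))
| eqtm_case_inr G A B C d e b :
    isty G A -> isty G B -> isty (tSum A B :: G) C ->
    hastm (A :: G) d (motive_inl C) -> hastm (B :: G) e (motive_inr C) ->
    hastm G b B ->
    eqtm G (tCase C d e (tInr b)) (inst1 e b) (inst1 C (tInr b))
| eqtm_J_refl G A C d a :
    isty G A -> isty (ctx_J G A) C -> hastm (A :: G) d (motive_refl C) ->
    hastm G a A ->
    eqtm G (tJ C d a a (tRefl a)) (inst1 d a) (inst3 C a a (tRefl a))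
| eqtm_trRec_tr G A P h f a :
    hastm G A tU -> hastm G P tU -> hastm G h (tIsProp P) ->
    hastm G f (tArr A P) -> hastm G a A ->
    eqtm G (tTrRec P h f (tTr a)) (tApp f a) P
(* congruence rules *)
| eqtm_Pi G A A' B B' :
    hastm G A tU -> eqtm G A A' tU -> eqtm (A :: G) B B' tU ->
    eqtm G (tPi A B) (tPi A' B') tU
| eqtm_Sig G A A' B B' :
    hastm G A tU -> eqtm G A A' tU -> eqtm (A :: G) B B' tU ->
    eqtm G (tSig A B) (tSig A' B') tU
| eqtm_Sum G A A' B B' :
    eqtm G A A' tU -> eqtm G B B' tU -> eqtm G (tSum A B) (tSum A' B') tU
| eqtm_Id G A A' a a' b b' :
    eqtm G A A' tU -> eqtm G a a' A -> eqtm G b b' A ->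
    eqtm G (tId A a b) (tId A' a' b') tU
| eqtm_Trunc G A A' : eqtm G A A' tU -> eqtm G (tTrunc A) (tTrunc A') tU
| eqtm_lam G A A' B t t' :
    isty G A -> eqty G A A' -> eqtm (A :: G) t t' B ->
    eqtm G (tLam A t) (tLam A' t') (tPi A B)
| eqtm_app G A B f f' a a' :
    eqtm G f f' (tPi A B) -> eqtm G a a' A ->
    eqtm G (tApp f a) (tApp f' a') (inst1 B a)
| eqtm_pair G A B a a' b b' :
    isty G A -> isty (A :: G) B -> eqtm G a a' A -> eqtm G b b' (inst1 B a) ->
    eqtm G (tPair a b) (tPair a' b') (tSig A B)
| eqtm_split G A B C C' d d' p p' :
    isty G A -> isty (A :: G) B -> eqty (tSig A B :: G) C C' ->
    eqtm (B :: A :: G) d d' (motive_pair C) -> eqtm G p p' (tSig A B) ->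
    eqtm G (tSplit C d p) (tSplit C' d' p') (inst1 C p)
| eqtm_inl G A B a a' :
    isty G B -> eqtm G a a' A -> eqtm G (tInl a) (tInl a') (tSum A B)
| eqtm_inr G A B b b' :
    isty G A -> eqtm G b b' B -> eqtm G (tInr b) (tInr b') (tSum A B)
| eqtm_case G A B C C' d d' e e' s s' :
    isty G A -> isty G B -> eqty (tSum A B :: G) C C' ->
    eqtm (A :: G) d d' (motive_inl C) -> eqtm (B :: G) e e' (motive_inr C) ->
    eqtm G s s' (tSum A B) ->
    eqtm G (tCase C d e s) (tCase C' d' e' s') (inst1 C s)
| eqtm_refl_cong G A a a' :
    eqtm G a a' A -> eqtm G (tRefl a) (tRefl a') (tId A a a)
| eqtm_J G A C C' d d' a a' b b' p p' :
    isty G A -> eqty (ctx_J G A) C C' -> eqtm (A :: G) d d' (motive_refl C) ->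
    eqtm G a a' A -> eqtm G b b' A -> eqtm G p p' (tId A a b) ->
    eqtm G (tJ C d a b p) (tJ C' d' a' b' p') (inst3 C a b p)
| eqtm_tr G A a a' :
    hastm G A tU -> eqtm G a a' A -> eqtm G (tTr a) (tTr a') (tTrunc A)
| eqtm_trProp G A A' :
    eqtm G A A' tU ->
    eqtm G (tTrProp A) (tTrProp A') (tIsProp (tTrunc A))
| eqtm_trRec G A P P' h h' f f' t t' :
    hastm G A tU -> eqtm G P P' tU -> eqtm G h h' (tIsProp P) ->
    eqtm G f f' (tArr A P) -> eqtm G t t' (tTrunc A) ->
    eqtm G (tTrRec P h f t) (tTrRec P' h' f' t') P.

(* Main.v *)
(** For [z : ||X||] the singleton [sum (y : Y), y = fbar z] is a proposition, so
    the truncation eliminates into it: send [x : X] to [f x] together with the path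
    [f x = fbar |x| = fbar z], whose second half comes from [||X||] being a
    proposition.  The first projection of the result at [z] is [f' z], and at
    [z = |x|] both the truncation and the projection compute, so that [f' |x|] is
    judgmentally [f x]. The term [f' z] is a construction uniform in [z] and typed in
    every context, so weakening is the only structural rule that has to be shown
    admissible. *)
Require Import Defs.
From Stdlib Require Import List.
Import ListNotations.

(** * Renamings and substitutions of raw terms *)

Lemma up_ext s s' : (forall n, s n = s' n) -> forall n, up s n = up s' n.
Proof. intros H [|n]; cbn; [reflexivity | now rewrite H]. Qed.

Lemma subst_ext t : forall s s',
  (forall n, s n = s' n) -> subst s t = subst s' t.
Proof. induction t; intros s s' H; cbn; auto; f_equal; auto using up_ext. Qed.

(** Here and in the two composition laws below, the composite [s'] is a parameter specified
    pointwise. Passing under a binder then asks only for another pointwise equation, and function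
    extensionality is avoided. *)
Lemma subst_ren t : forall s r s',
  (forall n, s (r n) = s' n) -> subst s (ren r t) = subst s' t.
Proof.
  assert (U : forall s r s', (forall n, s (r n) = s' n) ->
            forall n, up s (up_ren r n) = up s' n)
    by (intros s r s' H [|n]; cbn; [reflexivity | now rewrite H]).
  induction t; intros s r s' H; cbn; auto; f_equal; auto 10.
Qed.

Lemma subst_id t : forall s, (forall n, s n = tVar n) -> subst s t = t.
Proof.
  assert (U : forall s, (forall n, s n = tVar n) -> forall n, up s n = tVar n)
    by (intros s H [|n]; cbn; [reflexivity | now rewrite H]).
  induction t; intros s H; cbn; auto; f_equal; auto 10.
Qed.

Lemma ren_as_subst r t : ren r t = subst (fun n => tVar (r n)) t.
Proof.
  rewrite <- (subst_id (ren r t) tVar) by reflexivity.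
  now apply subst_ren.
Qed.

Lemma ren_subst t : forall r s s',
  (forall n, ren r (s n) = s' n) -> ren r (subst s t) = subst s' t.
Proof.
  assert (U : forall r s s', (forall n, ren r (s n) = s' n) ->
            forall n, ren (up_ren r) (up s n) = up s' n).
  { intros r s s' H [|n]; cbn; [reflexivity |].
    rewrite <- H. unfold wk. rewrite !(ren_as_subst _ (ren _ _)).
    now rewrite !(subst_ren _ _ _ (fun k => tVar (S (r k)))). }
  induction t; intros r s s' H; cbn; auto; f_equal; auto 10.
Qed.

(** Since [up] weakens the terms of a substitution, lifting a composite under a binder uses both
    mixed laws, [subst_ren] and [ren_subst]. *)
Lemma subst_subst t : forall s1 s2 s',
  (forall n, subst s2 (s1 n) = s' n) -> subst s2 (subst s1 t) = subst s' t.
Proof.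
  assert (U : forall s1 s2 s', (forall n, subst s2 (s1 n) = s' n) ->
            forall n, subst (up s2) (up s1 n) = up s' n).
  { intros s1 s2 s' H [|n]; cbn; [reflexivity |].
    rewrite <- H. unfold wk.
    rewrite (subst_ren _ _ _ (fun k => wk (s2 k))) by reflexivity.
    symmetry. now apply ren_subst. }
  induction t; intros s1 s2 s' H; cbn; auto; f_equal; auto 10.
Qed.

(** Renamings become substitutions and nested substitutions are merged, so that each metavariable
    ends up under a single explicit substitution. *)
Ltac tm_norm :=
  unfold tIsProp, tArr, ctx_J, inst1, inst2, inst3, motive_pair, motive_inl,
    motive_inr, motive_refl; simpl;
  repeat (first [ progress unfold wk
                | rewrite ren_as_subst
                | erewrite subst_subst by (intro; reflexivity) ]; simpl).

(** The substitutions compared are explicit on the first few indices and uniform beyond them, so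
    finitely many case splits settle pointwise equality. *)
Ltac var_cases := let n := fresh "n" in
  intro n; do 6 (try destruct n as [|n]); simpl;
  rewrite ?ren_as_subst; reflexivity.

(* Decides equality of terms built from metavariables by syntax, renamings and
   substitutions that are explicit up to finitely many indices. *)
Ltac tm_eq :=
  tm_norm;
  repeat first
    [ reflexivity
    | match goal with
      | |- subst _ ?t = subst _ ?t => apply subst_ext; var_cases
      | |- subst _ ?t = ?t => apply subst_id; var_cases
      | |- ?t = subst _ ?t => symmetry; apply subst_id; var_cases
      | |- subst _ _ = _ => fail 1
      | |- _ = subst _ _ => fail 1
      end
    | f_equal ].

(** * Commutation of renaming with instantiation, motives and derived types *)

Lemma ren_inst1 r t a : ren r (inst1 t a) = inst1 (ren (up_ren r) t) (ren r a).
Proof. tm_eq. Qed.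
Lemma ren_inst2 r t a b :
  ren r (inst2 t a b) = inst2 (ren (up_ren (up_ren r)) t) (ren r a) (ren r b).
Proof. tm_eq. Qed.
Lemma ren_inst3 r t a b c :
  ren r (inst3 t a b c) =
  inst3 (ren (up_ren (up_ren (up_ren r))) t) (ren r a) (ren r b) (ren r c).
Proof. tm_eq. Qed.
Lemma ren_motive_pair r C :
  ren (up_ren (up_ren r)) (motive_pair C) = motive_pair (ren (up_ren r) C).
Proof. tm_eq. Qed.
Lemma ren_motive_inl r C :
  ren (up_ren r) (motive_inl C) = motive_inl (ren (up_ren r) C).
Proof. tm_eq. Qed.
Lemma ren_motive_inr r C :
  ren (up_ren r) (motive_inr C) = motive_inr (ren (up_ren r) C).
Proof. tm_eq. Qed.
Lemma ren_motive_refl r C :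
  ren (up_ren r) (motive_refl C) =
  motive_refl (ren (up_ren (up_ren (up_ren r))) C).
Proof. tm_eq. Qed.
Lemma ren_wk r t : ren (up_ren r) (wk t) = wk (ren r t).
Proof. tm_eq. Qed.
Lemma ren_isProp r A : ren r (tIsProp A) = tIsProp (ren r A).
Proof. tm_eq. Qed.
Lemma ren_arr r A B : ren r (tArr A B) = tArr (ren r A) (ren r B).
Proof. tm_eq. Qed.

(** * Weakening *)

Scheme wf_mut := Induction for wf Sort Prop
with isty_mut := Induction for isty Sort Prop
with eqty_mut := Induction for eqty Sort Prop
with hastm_mut := Induction for hastm Sort Prop
with eqtm_mut := Induction for eqtm Sort Prop.
Combined Scheme judgment_ind from wf_mut, isty_mut, eqty_mut, hastm_mut, eqtm_mut.

(** Context entries live over different prefixes, so they are compared only after being shifted into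
    the full contexts, the form in which [hastm_var] gives types. *)
Definition wt_ren (D : ctx) (r : nat -> nat) (G : ctx) : Prop :=
  forall n A, nth_error G n = Some A ->
  exists B, nth_error D (r n) = Some B /\
    ren (fun k => S (r n) + k) B = ren r (ren (fun k => S n + k) A).

Lemma wt_ren_shift D r G A : wt_ren D r G -> wt_ren (A :: D) (fun k => S (r k)) G.
Proof.
  intros H n B E. destruct (H n B E) as [B' [E' Q]].
  exists B'. split; [exact E' |].
  transitivity (wk (ren (fun k => S (r n) + k) B')); [| rewrite Q]; tm_eq.
Qed.

Lemma wt_ren_up D r G A :
  wt_ren D r G -> wt_ren (ren r A :: D) (up_ren r) (A :: G).
Proof.
  intros H [|n] B E; cbn in E.
  - injection E as <-. exists (ren r A). split; [reflexivity | tm_eq].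
  - destruct (wt_ren_shift _ _ _ (ren r A) H n B E) as [B' [E' Q]].
    exists B'. split; [exact E' |]. cbn [up_ren]. rewrite Q. tm_eq.
Qed.

Lemma hastm_var_eq G n A B :
  wf G -> nth_error G n = Some A -> ren (fun k => S n + k) A = B ->
  hastm G (tVar n) B.
Proof. intros W E <-. now apply hastm_var. Qed.

(** The weakenings of [A] are premises because this lemma is used inside the proof of weakening
    itself. *)
Lemma wf_ctx_J G A : wf G -> isty G A -> isty (A :: G) (wk A) ->
  isty (wk A :: A :: G) (wk (wk A)) -> wf (ctx_J G A).
Proof.
  intros W HA HA1 HA2.
  assert (W2 : wf (wk A :: A :: G)) by auto using wf_cons.
  constructor; [exact W2 |].
  constructor; [exact HA2 | |];
    (eapply hastm_var_eq; [exact W2 | reflexivity | tm_eq]).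
Qed.

(* The induction hypothesis for [A], taken along [r] followed by shifts, provides
   the weakenings of [A] that occur in the context of the motive of [tJ]. *)
Lemma wf_ctx_J_ren D r G A :
  (forall D r, wf D -> wt_ren D r G -> isty D (ren r A)) ->
  wf D -> wt_ren D r G -> wf (ctx_J D (ren r A)).
Proof.
  intros HA W H.
  assert (A0 : isty D (ren r A)) by auto.
  assert (A1 : isty (ren r A :: D) (wk (ren r A))).
  { replace (wk (ren r A)) with (ren (fun k => S (r k)) A) by tm_eq.
    apply HA; [now constructor | now apply wt_ren_shift]. }
  apply wf_ctx_J; auto.
  replace (wk (wk (ren r A))) with (ren (fun k => S (S (r k))) A) by tm_eq.
  apply HA; [auto using wf_cons |].
  apply (wt_ren_shift _ (fun k => S (r k))). now apply wt_ren_shift.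
Qed.

Lemma wt_ren_ctx_J D r G A :
  wt_ren D r G ->
  wt_ren (ctx_J D (ren r A)) (up_ren (up_ren (up_ren r))) (ctx_J G A).
Proof.
  intros H. unfold ctx_J.
  apply (wt_ren_up _ _ _ A) in H. apply (wt_ren_up _ _ _ (wk A)) in H.
  apply (wt_ren_up _ _ _ (tId (wk (wk A)) (tVar 1) (tVar 0))) in H.
  cbn [ren up_ren] in H. now rewrite !ren_wk in H.
Qed.

(** Arbitrary renamings are needed because a shift becomes a lifted shift under a binder.
    Well-formedness of the target is assumed, and is re-established at each binder from the renamed
    type premise of the rule. *)
Lemma judgment_ren :
  (forall G, wf G -> True) /\
  (forall G A, isty G A ->
     forall D r, wf D -> wt_ren D r G -> isty D (ren r A)) /\
  (forall G A B, eqty G A B ->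
     forall D r, wf D -> wt_ren D r G -> eqty D (ren r A) (ren r B)) /\
  (forall G t A, hastm G t A ->
     forall D r, wf D -> wt_ren D r G -> hastm D (ren r t) (ren r A)) /\
  (forall G t u A, eqtm G t u A ->
     forall D r, wf D -> wt_ren D r G -> eqtm D (ren r t) (ren r u) (ren r A)).
Proof.
  apply judgment_ind; auto; intros; cbn [ren];
    rewrite ?ren_inst1, ?ren_inst2, ?ren_inst3, ?ren_isProp, ?ren_arr; cbn [ren].
  all: try (match goal with E : nth_error _ _ = Some _, H : wt_ren _ _ _ |- _ =>
    destruct (H _ _ E) as [? [? ?]] end; eapply hastm_var_eq; now eauto).
  all: try (econstructor; now eauto 6 using wf_cons, wt_ren_up, isty_El).
  (* For the remaining rules, types that occur only in premises are supplied explicitly as the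
     renamed types of the original derivation. *)
  all: match goal with
    | |- hastm _ (tPair _ _) _ => apply hastm_pair
    | |- hastm _ (tSplit _ _ _) _ =>
        apply hastm_split with (A := ren r A) (B := ren (up_ren r) B)
    | |- hastm _ (tCase _ _ _ _) _ =>
        apply hastm_case with (A := ren r A) (B := ren r B)
    | |- hastm _ (tJ _ _ _ _ _) _ => apply hastm_J with (A := ren r A)
    | |- hastm _ (tTrRec _ _ _ _) _ => apply hastm_trRec with (A := ren r A)
    | |- eqtm _ _ (tLam _ (tApp _ _)) _ => rewrite ren_wk; apply eqtm_eta
    | |- eqtm _ _ (inst2 _ _ _) _ =>
        apply eqtm_split_pair with (A := ren r A) (B := ren (up_ren r) B)
    | |- eqtm _ (tCase _ _ _ (tInl _)) (inst1 _ _) _ =>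
        apply eqtm_case_inl with (A := ren r A) (B := ren r B)
    | |- eqtm _ (tCase _ _ _ (tInr _)) (inst1 _ _) _ =>
        apply eqtm_case_inr with (A := ren r A) (B := ren r B)
    | |- eqtm _ _ (inst1 _ _) _ => apply eqtm_J_refl with (A := ren r A)
    | |- eqtm _ _ (tApp _ _) _ => apply eqtm_trRec_tr with (A := ren r A)
    | |- eqtm _ (tPair _ _) _ _ => apply eqtm_pair
    | |- eqtm _ (tSplit _ _ _) _ _ =>
        apply eqtm_split with (A := ren r A) (B := ren (up_ren r) B)
    | |- eqtm _ (tCase _ _ _ _) _ _ =>
        apply eqtm_case with (A := ren r A) (B := ren r B)
    | |- eqtm _ (tJ _ _ _ _ _) _ _ => apply eqtm_J with (A := ren r A)
    | |- eqtm _ (tTrRec _ _ _ _) _ _ => apply eqtm_trRec with (A := ren r A)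
    end.
  (* Renaming is pulled back outside motives and instances, to match the induction hypotheses. *)
  all: rewrite <- ?ren_motive_pair, <- ?ren_motive_inl, <- ?ren_motive_inr,
    <- ?ren_motive_refl, <- ?ren_inst1, <- ?ren_isProp, <- ?ren_arr.
  all: try now auto 7 using wf_cons, wt_ren_up, isty_El.
  (* What is left are the motives, which live over a pair type, a sum type or the context of
     [tJ]. *)
  all: match goal with
    | H : _ |- isty (tSig _ _ :: _) _ => apply H
    | H : _ |- isty (tSum _ _ :: _) _ => apply H
    | H : _ |- eqty (tSig _ _ :: _) _ _ => apply H
    | H : _ |- eqty (tSum _ _ :: _) _ _ => apply H
    | H : _ |- isty (ctx_J _ _) _ => apply H
    | H : _ |- eqty (ctx_J _ _) _ _ => apply H
    end.
  all: first [now apply wf_ctx_J_ren with (G := G) | now apply wt_ren_ctx_J | idtac].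
  all: first [now apply (wt_ren_up _ _ _ (tSig A B)) | now apply (wt_ren_up _ _ _ (tSum A B)) | apply wf_cons; auto].
  all: first [apply isty_Sig | apply isty_Sum]; auto 6 using wf_cons, wt_ren_up.
Qed.

Lemma wt_ren_S G A : wt_ren (A :: G) S G.
Proof. intros n B E. exists B. split; [exact E | tm_eq]. Qed.

Lemma isty_wk G A B : wf (A :: G) -> isty G B -> isty (A :: G) (wk B).
Proof. intros W H. eapply judgment_ren; eauto using wt_ren_S. Qed.

Lemma hastm_wk G A t B :
  wf (A :: G) -> hastm G t B -> hastm (A :: G) (wk t) (wk B).
Proof. intros W H. eapply judgment_ren; eauto using wt_ren_S. Qed.

(** * Singletons and transport *)

(** Typing rules produce types in substituted form, such as [inst1 B a]. The mismatch with the
    expected type becomes a syntactic equation for [tm_eq]. *)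
Lemma hastm_conv_eq G t A B : hastm G t A -> A = B -> hastm G t B.
Proof. now intros H <-. Qed.

Lemma eqtm_conv_eq G t u u' A B : eqtm G t u A -> u = u' -> A = B -> eqtm G t u' B.
Proof. now intros H <- <-. Qed.

Lemma hastm_wkU G A B : wf (A :: G) -> hastm G B tU -> hastm (A :: G) (wk B) tU.
Proof. exact (hastm_wk G A B tU). Qed.

Lemma hastm_tapp G A B f a :
  hastm G f (tArr A B) -> hastm G a A -> hastm G (tApp f a) B.
Proof.
  intros Hf Ha. eapply hastm_conv_eq; [exact (hastm_app _ _ _ _ _ Hf Ha) | tm_eq].
Qed.

(** The path points towards [c], the direction in which [h] provides it. *)
Definition sing (Y c : tm) : tm := tSig Y (tId (wk Y) (tVar 0) (wk c)).

Ltac sing_eq := unfold sing; tm_eq.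

Ltac var := eapply hastm_var_eq; [eassumption | reflexivity | sing_eq].

Lemma wk_sing Y c : wk (sing Y c) = sing (wk Y) (wk c).
Proof. sing_eq. Qed.

Lemma sing_fiber_U G Y c : wf G -> hastm G Y tU -> hastm G c Y ->
  hastm (Y :: G) (tId (wk Y) (tVar 0) (wk c)) tU.
Proof.
  intros W HY Hc.
  assert (W1 : wf (Y :: G)) by auto using wf_cons, isty_El.
  apply hastm_Id; [auto using hastm_wkU | var | auto using hastm_wk].
Qed.

Lemma hastm_sing G Y c : wf G -> hastm G Y tU -> hastm G c Y ->
  hastm G (sing Y c) tU.
Proof. intros. apply hastm_Sig; auto using sing_fiber_U. Qed.

Lemma hastm_sing_pair G Y c y p : wf G -> hastm G Y tU -> hastm G c Y ->
  hastm G y Y -> hastm G p (tId Y y c) -> hastm G (tPair y p) (sing Y c).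
Proof.
  intros W HY Hc Hy Hp. apply hastm_pair; auto using isty_El, sing_fiber_U.
  eapply hastm_conv_eq; [exact Hp | tm_eq].
Qed.

Lemma wf_ctx_J_U G Y : wf G -> hastm G Y tU -> wf (ctx_J G Y).
Proof.
  intros W HY. assert (W1 : wf (Y :: G)) by auto using wf_cons, isty_El.
  assert (W2 : wf (wk Y :: Y :: G)) by auto using wf_cons, isty_El, hastm_wkU.
  apply wf_ctx_J; auto using isty_El, hastm_wkU.
Qed.

Lemma wk3_ctx_J G Y t A : wf G -> hastm G Y tU -> hastm G t A ->
  hastm (ctx_J G Y) (wk (wk (wk t))) (wk (wk (wk A))).
Proof.
  intros W HY Ht. pose proof (wf_ctx_J_U _ _ W HY) as W3.
  assert (W1 : wf (Y :: G)) by auto using wf_cons, isty_El.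
  assert (W2 : wf (wk Y :: Y :: G)) by auto using wf_cons, isty_El, hastm_wkU.
  apply hastm_wk; [exact W3 |]. auto using hastm_wk.
Qed.

(* [refl c = p] as points of the singleton of [c], for [p : y = c]. *)
Definition sing_refl_path (Y c y p : tm) : tm :=
  let Y3 := wk (wk (wk Y)) in
  tJ (tId (sing Y3 (tVar 1)) (tPair (tVar 1) (tRefl (tVar 1)))
        (tPair (tVar 2) (tVar 0)))
     (tRefl (tPair (tVar 0) (tRefl (tVar 0)))) y c p.

(** The motive generalises both endpoints, so the singleton is centred at the varying right
    endpoint. On the diagonal the two pairs coincide and [tRefl] suffices. *)
Lemma hastm_sing_refl_path G Y c y p : wf G -> hastm G Y tU -> hastm G c Y ->
  hastm G y Y -> hastm G p (tId Y y c) ->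
  hastm G (sing_refl_path Y c y p)
    (tId (sing Y c) (tPair c (tRefl c)) (tPair y p)).
Proof.
  intros W HY Hc Hy Hp.
  assert (W1 : wf (Y :: G)) by auto using wf_cons, isty_El.
  pose proof (wf_ctx_J_U _ _ W HY) as W3.
  assert (HY3 := wk3_ctx_J _ _ _ _ W HY HY).
  assert (V1 : hastm (ctx_J G Y) (tVar 1) (wk (wk (wk Y)))) by var.
  assert (V0 : hastm (Y :: G) (tVar 0) (wk Y)) by var.
  eapply hastm_conv_eq.
  - apply hastm_J with (A := Y); auto using isty_El.
    + apply isty_El, hastm_Id.
      * now apply hastm_sing.
      * apply hastm_sing_pair; auto. now apply hastm_refl.
      * apply hastm_sing_pair; auto; var.
    + eapply hastm_conv_eq; [apply hastm_refl, hastm_sing_pair |];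
        [exact W1 | exact (hastm_wkU _ _ _ W1 HY) | exact V0 | exact V0
        | exact (hastm_refl _ _ _ V0) | sing_eq].
  - sing_eq.
Qed.

(** Path induction on [p] turns the given point into the centre with its reflexivity path. Splitting
    the other point then leaves [sing_refl_path], so no path has to be inverted or composed. *)
Definition sing_contr (Y c y p : tm) : tm :=
  let Y1 := wk Y in let Y3 := wk (wk (wk Y)) in
  tJ (tPi (sing Y3 (tVar 1))
        (tId (wk (sing Y3 (tVar 1))) (tPair (tVar 3) (tVar 1)) (tVar 0)))
     (tLam (sing Y1 (tVar 0))
        (tSplit (tId (sing Y3 (tVar 2)) (tPair (tVar 2) (tRefl (tVar 2))) (tVar 0))
           (sing_refl_path (wk Y3) (tVar 3) (tVar 1) (tVar 0)) (tVar 0)))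
     y c p.

Lemma hastm_sing_contr G Y c y p : wf G -> hastm G Y tU -> hastm G c Y ->
  hastm G y Y -> hastm G p (tId Y y c) ->
  hastm G (sing_contr Y c y p)
    (tPi (sing Y c) (tId (wk (sing Y c)) (tPair (wk y) (wk p)) (tVar 0))).
Proof.
  intros W HY Hc Hy Hp.
  assert (W1 : wf (Y :: G)) by auto using wf_cons, isty_El.
  pose proof (wf_ctx_J_U _ _ W HY) as WJ.
  assert (HY3 := wk3_ctx_J _ _ _ _ W HY HY).
  assert (V1 : hastm (ctx_J G Y) (tVar 1) (wk (wk (wk Y)))) by var.
  assert (V0 : hastm (Y :: G) (tVar 0) (wk Y)) by var.
  assert (HY1 : hastm (Y :: G) (wk Y) tU) by auto using hastm_wkU.
  eapply hastm_conv_eq.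
  - apply hastm_J with (A := Y); auto using isty_El.
    + assert (HS := hastm_sing _ _ _ WJ HY3 V1).
      assert (WS := wf_cons _ _ WJ (isty_El _ _ HS)).
      apply isty_El, hastm_Pi; [exact HS |]. apply hastm_Id.
      * now apply hastm_wkU.
      * rewrite wk_sing. apply hastm_sing_pair; auto using hastm_wkU; var.
      * var.
    + assert (HS := hastm_sing _ _ _ W1 HY1 V0).
      assert (WS := wf_cons _ _ W1 (isty_El _ _ HS)).
      assert (HY2 := hastm_wkU _ _ _ WS HY1).
      assert (U1 : hastm (sing (wk Y) (tVar 0) :: Y :: G) (tVar 1) (wk (wk Y)))
        by var.
      assert (HS2 := hastm_sing _ _ _ WS HY2 U1).
      assert (WS2 := wf_cons _ _ WS (isty_El _ _ HS2)).
      assert (HY3' := hastm_wkU _ _ _ WS2 HY2).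
      assert (WY2 := wf_cons _ _ WS (isty_El _ _ HY2)).
      assert (HF := sing_fiber_U _ _ _ WS HY2 U1).
      assert (WF := wf_cons _ _ WY2 (isty_El _ _ HF)).
      assert (U2 : hastm (sing (wk (wk Y)) (tVar 1) :: sing (wk Y) (tVar 0) :: Y :: G)
         (tVar 2) (wk (wk (wk Y)))) by var.
      eapply hastm_conv_eq.
      * apply hastm_lam; [now apply isty_El |].
        apply hastm_split with (A := wk (wk Y))
          (B := tId (wk (wk (wk Y))) (tVar 0) (wk (tVar 1))).
        -- now apply isty_El.
        -- now apply isty_El.
        -- apply isty_El, hastm_Id.
           ++ now apply hastm_sing.
           ++ apply hastm_sing_pair; auto using hastm_refl.
           ++ var.
        -- eapply hastm_conv_eq; [apply hastm_sing_refl_path | sing_eq];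
             auto using hastm_wkU; var.
        -- var.
      * sing_eq.
  - sing_eq.
Qed.

(** Only the first point is split. The motive keeps the second one quantified, which is the form
    that [sing_contr] delivers. *)
Definition sing_isProp (Y c : tm) : tm :=
  let S := sing Y c in
  tLam S (tSplit (tPi (wk (wk S)) (tId (wk (wk (wk S))) (tVar 1) (tVar 0)))
            (sing_contr (wk (wk (wk Y))) (wk (wk (wk c))) (tVar 1) (tVar 0))
            (tVar 0)).

Lemma hastm_sing_isProp G Y c : wf G -> hastm G Y tU -> hastm G c Y ->
  hastm G (sing_isProp Y c) (tIsProp (sing Y c)).
Proof.
  intros W HY Hc.
  assert (HS := hastm_sing _ _ _ W HY Hc).
  assert (WS := wf_cons _ _ W (isty_El _ _ HS)).
  assert (HY1 := hastm_wkU _ _ _ WS HY).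
  assert (Hc1 := hastm_wk _ _ _ _ WS Hc).
  assert (HS1 := hastm_wkU _ _ _ WS HS).
  assert (WS2 := wf_cons _ _ WS (isty_El _ _ HS1)).
  assert (HS2 := hastm_wkU _ _ _ WS2 HS1).
  assert (WS3 := wf_cons _ _ WS2 (isty_El _ _ HS2)).
  assert (WY1 := wf_cons _ _ WS (isty_El _ _ HY1)).
  assert (HF := sing_fiber_U _ _ _ WS HY1 Hc1).
  assert (WF := wf_cons _ _ WY1 (isty_El _ _ HF)).
  apply hastm_lam; [now apply isty_El |].
  eapply hastm_conv_eq.
  - apply hastm_split with (A := wk Y)
      (B := tId (wk (wk Y)) (tVar 0) (wk (wk c))).
    + now apply isty_El.
    + now apply isty_El.
    + change (tSig _ _) with (sing (wk Y) (wk c)). rewrite <- wk_sing.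
      apply isty_El, hastm_Pi; [exact HS2 |].
      apply hastm_Id; [now apply hastm_wkU | var | var].
    + eapply hastm_conv_eq; [apply hastm_sing_contr | sing_eq];
        auto using hastm_wkU, hastm_wk; var.
    + var.
  - sing_eq.
Qed.

(** The type of [q] depends on the endpoint [a], so the motive is a function type from [c = g a] to
    [c = g b]. It is inhabited by the identity on the diagonal, and the result is applied to [q]. *)
Definition transp_path (Y c g a b p q : tm) : tm :=
  let Y3 := wk (wk (wk Y)) in
  let c3 := wk (wk (wk c)) in
  let g3 := wk (wk (wk g)) in
  tApp (tJ (tArr (tId Y3 c3 (tApp g3 (tVar 2))) (tId Y3 c3 (tApp g3 (tVar 1))))
          (tLam (tId (wk Y) (wk c) (tApp (wk g) (tVar 0))) (tVar 0)) a b p) q.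

Lemma hastm_transp_path G T Y c g a b p q :
  wf G -> hastm G T tU -> hastm G Y tU -> hastm G c Y -> hastm G g (tArr T Y) ->
  hastm G a T -> hastm G b T -> hastm G p (tId T a b) ->
  hastm G q (tId Y c (tApp g a)) ->
  hastm G (transp_path Y c g a b p q) (tId Y c (tApp g b)).
Proof.
  intros W HT HY Hc Hg Ha Hb Hp Hq.
  assert (W1 : wf (T :: G)) by auto using wf_cons, isty_El.
  pose proof (wf_ctx_J_U _ _ W HT) as WJ.
  assert (HY3 := wk3_ctx_J _ _ _ _ W HT HY).
  assert (Hc3 := wk3_ctx_J _ _ _ _ W HT Hc).
  assert (Hg3 := wk3_ctx_J _ _ _ _ W HT Hg).
  eapply hastm_tapp; [| exact Hq].
  eapply hastm_conv_eq.
  - apply hastm_J with (A := T); auto using isty_El.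
    + assert (HL : forall n, hastm (ctx_J G T) (tVar n) (wk (wk (wk T))) ->
        hastm (ctx_J G T) (tId (wk (wk (wk Y))) (wk (wk (wk c)))
               (tApp (wk (wk (wk g))) (tVar n))) tU).
      { intros n Hn. apply hastm_Id; auto. eapply hastm_tapp; [| exact Hn].
        eapply hastm_conv_eq; [exact Hg3 | tm_eq]. }
      assert (H2 := HL 2 ltac:(var)). assert (H1 := HL 1 ltac:(var)).
      apply isty_El, hastm_Pi; auto.
      apply hastm_wkU; auto using wf_cons, isty_El.
    + assert (HI : hastm (T :: G) (tId (wk Y) (wk c) (tApp (wk g) (tVar 0))) tU).
      { apply hastm_Id; auto using hastm_wkU, hastm_wk.
        eapply hastm_tapp with (A := wk T); [| var].
        eapply hastm_conv_eq; [apply hastm_wk; eassumption | tm_eq]. }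
      assert (WI := wf_cons _ _ W1 (isty_El _ _ HI)).
      eapply hastm_conv_eq.
      * apply hastm_lam; [now apply isty_El |].
        eapply hastm_var_eq; [exact WI | reflexivity | reflexivity].
      * tm_eq.
  - tm_eq.
Qed.

(** * The improved function *)

(* The path [f x = fbar z], from [h x : f x = fbar |x|] and [|x| = z]. *)
Definition ext_path (X Y f fbar h z x : tm) : tm :=
  transp_path Y (tApp f x) fbar (tTr x) z
    (tApp (tApp (tTrProp X) (tTr x)) z) (tApp h x).

(** The point [z] is fixed before the recursion, so it may occur in the target proposition as well
    as in the scrutinee; the non-dependent [tTrRec] is therefore enough. *)
Definition ext_rec (X Y f fbar h z : tm) : tm :=
  tTrRec (sing Y (tApp fbar z)) (sing_isProp Y (tApp fbar z))
    (tLam X (tPair (tApp (wk f) (tVar 0))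
       (ext_path (wk X) (wk Y) (wk f) (wk fbar) (wk h) (wk z) (tVar 0)))) z.

(** First projection as a split with constant motive: in its branch [tVar 1] is the first
    component. *)
Definition ext_at (X Y f fbar h z : tm) : tm :=
  tSplit (wk Y) (tVar 1) (ext_rec X Y f fbar h z).

Definition homotopy_ty (X Y f fbar : tm) : tm :=
  tPi X (tId (wk Y) (tApp (wk f) (tVar 0)) (tApp (wk fbar) (tTr (tVar 0)))).

(** Bundled so that all the data can be weakened at once when the construction passes under a
    binder. *)
Record ext_data (G : ctx) (X Y f fbar h : tm) : Prop := {
  ed_wf : wf G;
  ed_X : hastm G X tU;
  ed_Y : hastm G Y tU;
  ed_f : hastm G f (tArr X Y);
  ed_fbar : hastm G fbar (tArr (tTrunc X) Y);
  ed_h : hastm G h (homotopy_ty X Y f fbar) }.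

Lemma ext_data_wk G A X Y f fbar h : wf (A :: G) -> ext_data G X Y f fbar h ->
  ext_data (A :: G) (wk X) (wk Y) (wk f) (wk fbar) (wk h).
Proof.
  intros W []. constructor; auto using hastm_wkU;
    (eapply hastm_conv_eq; [apply hastm_wk; eassumption |
      unfold homotopy_ty; tm_eq]).
Qed.

Lemma hastm_ext_path G X Y f fbar h z x : ext_data G X Y f fbar h ->
  hastm G z (tTrunc X) -> hastm G x X ->
  hastm G (ext_path X Y f fbar h z x) (tId Y (tApp f x) (tApp fbar z)).
Proof.
  intros [W HX HY Hf Hfbar Hh] Hz Hx.
  assert (Ht := hastm_tr _ _ _ HX Hx).
  apply hastm_transp_path with (T := tTrunc X);
    auto using hastm_Trunc; try (eapply hastm_tapp; eassumption).
  - eapply hastm_conv_eq.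
    (* After application to [|x|], the proof [tTrProp X] still awaits the second point; this
       codomain is then instantiated at [z]. *)
    + apply hastm_app with (A := tTrunc X)
        (B := tId (wk (tTrunc X)) (wk (tTr x)) (tVar 0)); [| exact Hz].
      eapply hastm_conv_eq;
        [exact (hastm_app _ _ _ _ _ (hastm_trProp _ _ HX) Ht) | tm_eq].
    + tm_eq.
  - eapply hastm_conv_eq; [exact (hastm_app _ _ _ _ _ Hh Hx) | tm_eq].
Qed.

Lemma hastm_ext_pair G X Y f fbar h z : ext_data G X Y f fbar h ->
  hastm G z (tTrunc X) ->
  hastm (X :: G) (tPair (tApp (wk f) (tVar 0))
      (ext_path (wk X) (wk Y) (wk f) (wk fbar) (wk h) (wk z) (tVar 0)))
    (wk (sing Y (tApp fbar z))).
Proof.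
  intros E Hz. assert (HX := ed_X _ _ _ _ _ _ E).
  assert (W1 := wf_cons _ _ (ed_wf _ _ _ _ _ _ E) (isty_El _ _ HX)).
  assert (E1 := ext_data_wk _ _ _ _ _ _ _ W1 E).
  assert (Hz1 := hastm_wk _ _ _ _ W1 Hz : hastm _ _ (tTrunc (wk X))).
  assert (V : hastm (X :: G) (tVar 0) (wk X)) by var.
  pose proof (hastm_ext_path _ _ _ _ _ _ _ _ E1 Hz1 V) as Hp.
  destruct E1. rewrite wk_sing.
  apply hastm_sing_pair; auto; eapply hastm_tapp; eassumption.
Qed.

Lemma hastm_ext_fun G X Y f fbar h z : ext_data G X Y f fbar h ->
  hastm G z (tTrunc X) ->
  hastm G (tLam X (tPair (tApp (wk f) (tVar 0))
       (ext_path (wk X) (wk Y) (wk f) (wk fbar) (wk h) (wk z) (tVar 0))))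
    (tArr X (sing Y (tApp fbar z))).
Proof.
  intros E Hz. apply hastm_lam.
  - apply isty_El. now destruct E.
  - now apply hastm_ext_pair.
Qed.

Lemma hastm_ext_rec G X Y f fbar h z : ext_data G X Y f fbar h ->
  hastm G z (tTrunc X) ->
  hastm G (ext_rec X Y f fbar h z) (sing Y (tApp fbar z)).
Proof.
  intros E Hz. pose proof (hastm_ext_fun _ _ _ _ _ _ _ E Hz) as HL. destruct E.
  assert (Hc := hastm_tapp _ _ _ _ _ ed_fbar0 Hz).
  apply hastm_trRec with (A := X); auto using hastm_sing, hastm_sing_isProp.
Qed.

Lemma hastm_pr1 G Y c : wf G -> hastm G Y tU -> hastm G c Y ->
  hastm (tId (wk Y) (tVar 0) (wk c) :: Y :: G) (tVar 1) (motive_pair (wk Y)).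
Proof.
  intros W HY Hc. assert (W1 := wf_cons _ _ W (isty_El _ _ HY)).
  assert (W2 := wf_cons _ _ W1 (isty_El _ _ (sing_fiber_U _ _ _ W HY Hc))).
  var.
Qed.

Lemma hastm_ext_at G X Y f fbar h z : ext_data G X Y f fbar h ->
  hastm G z (tTrunc X) -> hastm G (ext_at X Y f fbar h z) Y.
Proof.
  intros E Hz. pose proof (hastm_ext_rec _ _ _ _ _ _ _ E Hz) as Hr. destruct E.
  assert (Hc := hastm_tapp _ _ _ _ _ ed_fbar0 Hz).
  assert (HYS : isty (sing Y (tApp fbar z) :: G) (wk Y))
    by (apply isty_wk; auto using isty_El, wf_cons, hastm_sing).
  eapply hastm_conv_eq.
  - eapply hastm_split; [| | exact HYS | | exact Hr];
      auto using hastm_pr1, isty_El, sing_fiber_U.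
  - tm_eq.
Qed.

(** Three computation rules fire in turn: [tTrRec] at [|x|] yields the branch applied to [x], beta
    yields a pair with first component [f x], and [tSplit] extracts that component. *)
Lemma ext_at_tr G X Y f fbar h x : ext_data G X Y f fbar h -> hastm G x X ->
  eqtm G (ext_at X Y f fbar h (tTr x)) (tApp f x) Y.
Proof.
  intros E Hx.
  assert (Hz := hastm_tr _ _ _ (ed_X _ _ _ _ _ _ E) Hx).
  pose proof (hastm_ext_path _ _ _ _ _ _ _ _ E Hz Hx) as Hp.
  pose proof (hastm_ext_fun _ _ _ _ _ _ _ E Hz) as HL.
  pose proof E as [W HX HY Hf Hfbar Hh].
  assert (Hc := hastm_tapp _ _ _ _ _ Hfbar Hz).
  assert (Hfx := hastm_tapp _ _ _ _ _ Hf Hx).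
  assert (HS := hastm_sing _ _ _ W HY Hc).
  assert (HYS : isty (sing Y (tApp fbar (tTr x)) :: G) (wk Y))
    by (apply isty_wk; auto using isty_El, wf_cons).
  assert (Hr : eqtm G (ext_rec X Y f fbar h (tTr x))
    (tPair (tApp f x) (ext_path X Y f fbar h (tTr x) x)) (sing Y (tApp fbar (tTr x)))).
  { eapply eqtm_trans.
    - apply eqtm_trRec_tr with (A := X); auto using hastm_sing_isProp.
    - eapply eqtm_conv_eq.
      + apply eqtm_beta; [now apply isty_El | now apply hastm_ext_pair | exact Hx].
      + unfold ext_path, transp_path. tm_eq.
      + sing_eq. }
  eapply eqtm_trans.
  (* Congruence replaces the scrutinee by the computed pair; as the motive is constant, its instance
     is [Y] again. *)
  - eapply eqtm_conv_eq with (A := inst1 (wk Y) _); [| reflexivity | tm_eq].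
    eapply eqtm_split; [| | exact (eqty_refl _ _ HYS) | | exact Hr];
      auto using eqtm_refl, hastm_pr1, isty_El, sing_fiber_U.
  - eapply eqtm_conv_eq; [| reflexivity |].
    + eapply eqtm_split_pair; [| | exact HYS | | exact Hfx |];
        auto using hastm_pr1, isty_El, sing_fiber_U.
      eapply hastm_conv_eq; [exact Hp | tm_eq].
    + tm_eq.
Qed.

(** Uniformity in the parameters: the weakened [f'] is the same construction on the weakened
    data. *)
Lemma ren_up_ext_at r X Y f fbar h :
  ren (up_ren r) (ext_at (wk X) (wk Y) (wk f) (wk fbar) (wk h) (tVar 0)) =
  ext_at (wk (ren r X)) (wk (ren r Y)) (wk (ren r f)) (wk (ren r fbar))
    (wk (ren r h)) (tVar 0).
Proof.
  unfold ext_at, ext_rec, sing_isProp, sing_contr, sing_refl_path, ext_path,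
    transp_path, sing. tm_eq.
Qed.

(** Identifies the result of the outer beta step, when the abstracted body is instantiated at
    [z]. *)
Lemma inst1_ext_at X Y f fbar h z :
  inst1 (ext_at (wk X) (wk Y) (wk f) (wk fbar) (wk h) (tVar 0)) z =
  ext_at X Y f fbar h z.
Proof.
  unfold ext_at, ext_rec, sing_isProp, sing_contr, sing_refl_path, ext_path,
    transp_path, sing. tm_eq.
Qed.

Theorem theorem8p4 (G : ctx) (X Y f fbar h : tm)
  (HG : wf G)
  (HX : hastm G X tU)
  (HY : hastm G Y tU)
  (Hf : hastm G f (tArr X Y))
  (Hfbar : hastm G fbar (tArr (tTrunc X) Y))
  (Hh : hastm G h
          (tPi X (tId (wk Y) (tApp (wk f) (tVar 0))
                             (tApp (wk fbar) (tTr (tVar 0)))))) :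
  exists f' : tm,
    hastm G f' (tArr (tTrunc X) Y) /\
    eqtm (X :: G) (tApp (wk f) (tVar 0)) (tApp (wk f') (tTr (tVar 0))) (wk Y) /\
    hastm G (tLam X (tRefl (tApp (wk f) (tVar 0))))
      (tPi X (tId (wk Y) (tApp (wk f) (tVar 0))
                         (tApp (wk f') (tTr (tVar 0))))).
Proof.
  assert (E : ext_data G X Y f fbar h) by now constructor.
  (* Stated for every context: it is applied over [G] to type [f'] and over [X :: G] in the beta
     step. *)
  assert (body : forall G X Y f fbar h, ext_data G X Y f fbar h ->
    hastm (tTrunc X :: G)
      (ext_at (wk X) (wk Y) (wk f) (wk fbar) (wk h) (tVar 0)) (wk Y)).
  { clear. intros G X Y f fbar h E.
    assert (W : wf (tTrunc X :: G)).
    { destruct E. auto using wf_cons, isty_El, hastm_Trunc. }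
    apply hastm_ext_at; [now apply ext_data_wk | var]. }
  assert (WX := wf_cons _ _ HG (isty_El _ _ HX)).
  assert (EX := ext_data_wk _ _ _ _ _ _ _ WX E).
  assert (V : hastm (X :: G) (tVar 0) (wk X)) by var.
  exists (tLam (tTrunc X) (ext_at (wk X) (wk Y) (wk f) (wk fbar) (wk h) (tVar 0))).
  assert (Q : eqtm (X :: G) (tApp (wk f) (tVar 0))
    (tApp (wk (tLam (tTrunc X)
       (ext_at (wk X) (wk Y) (wk f) (wk fbar) (wk h) (tVar 0)))) (tTr (tVar 0)))
    (wk Y)).
  { apply eqtm_sym. eapply eqtm_trans; [| exact (ext_at_tr _ _ _ _ _ _ _ EX V)].
    (* Weakening moves through the abstraction onto the parameters, exposing a beta redex at
       [|x|]. *)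
    unfold wk at 1. cbn [ren]. rewrite ren_up_ext_at.
    eapply eqtm_conv_eq.
    - apply eqtm_beta.
      + apply isty_El, hastm_Trunc. now destruct EX.
      + exact (body _ _ _ _ _ _ EX).
      + apply hastm_tr; [now destruct EX | exact V].
    - apply inst1_ext_at.
    - tm_eq. }
  split; [| split; [exact Q |]].
  - apply hastm_lam; [now apply isty_El, hastm_Trunc | now apply body].
  - assert (Hfx : hastm (X :: G) (tApp (wk f) (tVar 0)) (wk Y)).
    { destruct EX. eapply hastm_tapp; eassumption. }
    apply hastm_lam; [now apply isty_El |].
    (* The reflexivity path ends at [f x]; the judgmental equality [Q] converts its type to the one
       ending at [f' |x|]. *)
    eapply hastm_conv; [exact (hastm_refl _ _ _ Hfx) |].
    apply eqty_Id; [| now apply eqtm_refl | exact Q].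
    apply eqty_refl, isty_El. now destruct EX.
Qed.
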